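(* Let $A$ and $B$ be non-trivial recursively presented groups, where $A$ has an infinite number of conjugacy classes and $B$ is finite and acts on a set $S$ transitively, so $S=B/H$ where $H$ is the stabiliser of some arbitrary point $s_0\in S$. The conjugacy problem in the permutational restricted wreath product $A\wr_S B$ is solvable if and only if the conjugacy problem is solvable in $A$.
   Context: A group is recursively presented if it has a presentation with finitely many generators and a recursively enumerable set of relators. Elements are given as words in the generators. The conjugacy problem is solvable if an algorithm decides, for any two words in the generators, whether they represent conjugate elements. $B$ acts on $S$ on the right. The permutational restricted wreath product is $A\wr_S B=\{(b,f): b\in B,\ f\in A^{(S)}\}$, where $A^{(S)}$ is the group (pointwise multiplication) of functions $f:S\to A$ with finite support, $f^{c}(s)=f(sc^{-1})$, and $(b,f)(c,g)=(bc,f^{c}g)$. It is generated by the elements $(b,1)$ with $b$ a generator of $B$ and $(1_B,a^{(s_0)})$ with $a$ a generator of $A$, where $a^{(s)}$ takes the value $a$ at $s$ and $1_A$ elsewhere. *)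

(* Defs.v *)
From HB Require Import structures.
From mathcomp Require Import all_boot all_fingroup finmap.
From mathcomp Require Import classical_sets cardinality.

Set Implicit Arguments.
Unset Strict Implicit.
Unset Printing Implicit Defensive.

Local Open Scope group_scope.

(* Partial recursive functions: [rec_fun n] is the syntax of the [n]-ary ones,
   and [rec_eval f v y] says that [f] halts on [v] with value [y]. *)

Inductive rec_fun : nat -> Type :=
| RecZero : rec_fun 0
| RecSucc : rec_fun 1
| RecProj n (i : 'I_n) : rec_fun n
| RecComp m n (f : rec_fun m) (g : 'I_m -> rec_fun n) : rec_fun n
| RecPrim n (f : rec_fun n) (g : rec_fun n.+2) : rec_fun n.+1
| RecMin n (f : rec_fun n.+1) : rec_fun n.

(* [RecPrim f g] is h with h(0, v) = f(v) and h(k + 1, v) = g(k, h(k, v), v);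
   the witness [s] below is the sequence k |-> h(k, v), and it need only be
   defined up to the recursion argument.  [RecMin f] maps v to the least y with
   f(y, v) = 0, and diverges as soon as some f(k, v) with k < y does. *)
Fixpoint rec_eval n (f : rec_fun n) : n.-tuple nat -> nat -> Prop :=
  match f in rec_fun n return n.-tuple nat -> nat -> Prop with
  | RecZero => fun _ y => y = 0
  | RecSucc => fun v y => y = (thead v).+1
  | RecProj _ i => fun v y => y = tnth v i
  | RecComp m _ f g => fun v y =>
      exists w : m.-tuple nat,
        (forall i, rec_eval (g i) v (tnth w i)) /\ rec_eval f w y
  | RecPrim _ f g => fun v y =>
      exists s : nat -> nat,
        [/\ rec_eval f [tuple of behead v] (s 0),
            forall k, (k < thead v)%N ->
              rec_eval g [tuple of k :: s k :: behead v] (s k.+1)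
          & y = s (thead v)]
  | RecMin _ f => fun v y =>
      rec_eval f [tuple of y :: v] 0 /\
      forall k, (k < y)%N -> exists z, rec_eval f [tuple of k :: v] z.+1
  end.

Lemma rec_eval_fun n (f : rec_fun n) v y z :
  rec_eval f v y -> rec_eval f v z -> y = z.
Proof.
elim: f v y z => //= {n}.
- by move=> _ y z -> ->.
- by move=> v y z -> ->.
- by move=> n i v y z -> ->.
- move=> m n f IHf g IHg v y z [w [gw fw]] [w' [gw' fw']].
  have E : w = w' by apply: eq_from_tnth => i; apply: IHg (gw i) (gw' i).
  by subst w'; apply: IHf fw fw'.
- move=> n f IHf g IHg v y z [s [s0 sS ->]] [t [t0 tS ->]].
  have : forall k, (k <= thead v)%N -> s k = t k.
    elim=> [_|k IHk kv]; first exact: IHf s0 t0.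
    have ek := IHk (ltnW kv); have := sS _ kv; have := tS _ kv.
    by rewrite -ek => a b; apply: IHg b a.
  by apply.
- move=> n f IHf v y z [y0 yP] [z0 zP].
  case: (ltngtP y z) => // lt.
    by have [w /IHf-/(_ _ y0)] := zP _ lt.
  by have [w /IHf-/(_ _ z0)] := yP _ lt.
Qed.

(* [(i, false)] is the i-th generator and [(i, true)] its inverse. *)
Definition letter n : Type := ('I_n * bool)%type.
Definition word n : Type := seq (letter n).

Definition inv_letter n (l : letter n) : letter n := (l.1, ~~ l.2).

Definition letter_code n (l : letter n) : nat := (l.1.*2 + l.2)%N.

(* Bijective numeration in base 2n, least significant letter first. *)
Definition word_code n (w : word n) : nat :=
  foldr (fun l c => (letter_code l + n.*2 * c).+1) 0 w.

Lemma letter_code_lt n (l : letter n) : (letter_code l < n.*2)%N.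
Proof.
case: l => i b; rewrite /letter_code /=.
apply: (@leq_trans i.+1.*2); last by rewrite leq_double ltn_ord.
by rewrite doubleS ltnS -addn1 leq_add2l; case: b.
Qed.

Lemma letter_code_inj n : injective (@letter_code n).
Proof.
move=> [i b] [j c]; rewrite /letter_code /= !(addnC _.*2) => e.
have eb : b = c by have := congr1 odd e; rewrite !oddD !odd_double !addbF !oddb.
by congr pair => //; apply: val_inj; have := congr1 half e; rewrite !half_bit_double.
Qed.

Lemma word_code_inj n : injective (@word_code n).
Proof.
elim=> [|l u IHu] [|m v] //= [e].
have n_gt0 : (0 < n.*2)%N by apply: leq_ltn_trans (letter_code_lt l).
rewrite !(addnC (letter_code _)) !(mulnC n.*2) in e.
have em := congr1 (modn^~ n.*2) e; have ed := congr1 (divn^~ n.*2) e.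
rewrite /= !modnMDl !modn_small ?letter_code_lt // in em.
rewrite /= !divnMDl // !divn_small ?letter_code_lt // !addn0 in ed.
by rewrite (letter_code_inj em) (IHu _ ed).
Qed.

Definition re_words n (R : word n -> Prop) : Prop :=
  exists f : rec_fun 1,
    forall w, R w <-> exists y, rec_eval f [tuple word_code w] y.

Definition decidable_words2 n (P : word n -> word n -> Prop) : Prop :=
  exists f : rec_fun 2, forall u v,
    (P u v -> rec_eval f [tuple word_code u; word_code v] 1) /\
    (~ P u v -> rec_eval f [tuple word_code u; word_code v] 0).

Definition word_val (G : groupType) n (x : 'I_n -> G) (w : word n) : G :=
  \prod_(l <- w) (if l.2 then (x l.1)^-1 else x l.1).

(* Equality of words in the group <X | R>: the congruence on words generated by
   free cancellation and the relators. *)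
Inductive pres_eq n (R : word n -> Prop) : word n -> word n -> Prop :=
| PresRefl u : pres_eq R u u
| PresSym u v : pres_eq R u v -> pres_eq R v u
| PresTrans u v w : pres_eq R u v -> pres_eq R v w -> pres_eq R u w
| PresCat u u' v v' :
    pres_eq R u u' -> pres_eq R v v' -> pres_eq R (u ++ v) (u' ++ v')
| PresCancel l : pres_eq R [:: l; inv_letter l] [::]
| PresRel r : R r -> pres_eq R r [::].

Definition is_presentation (G : groupType) n (x : 'I_n -> G)
    (R : word n -> Prop) : Prop :=
  (forall g : G, exists w, word_val x w = g) /\
  (forall u v, word_val x u = word_val x v <-> pres_eq R u v).

Definition recursively_presented (G : groupType) n (x : 'I_n -> G) : Prop :=
  exists R : word n -> Prop, re_words R /\ is_presentation x R.

Definition are_conjugate (G : groupType) (g h : G) : Prop :=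
  exists k : G, g ^ k = h.

Definition conjugacy_problem_solvable (G : groupType) n (x : 'I_n -> G) : Prop :=
  decidable_words2 (fun u v => are_conjugate (word_val x u) (word_val x v)).

Definition conj_class (G : groupType) (g : G) : set G :=
  [set h | are_conjugate g h]%classic.

Definition conj_classes (G : groupType) : set (set G) := range (@conj_class G).
Arguments conj_classes G : clear implicits.

Definition nontrivial (G : groupType) : Prop := exists g : G, g <> 1.

Definition transitive_action (B : finGroupType) (S : Type)
    (to : {action B &-> S}) : Prop :=
  forall s t : S, exists b : B, to s b = t.

(* The library has [actM] and [act1] only for actions on finite types. *)
Lemma total_actM (B : finGroupType) (S : Type) (to : {action B &-> S}) s b c :
  to s (b * c) = to (to s b) c.
Proof. by case: to => to [_ toM] /=; apply: toM; rewrite inE. Qed.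

Lemma total_act1 (B : finGroupType) (S : Type) (to : {action B &-> S}) s :
  to s 1 = s.
Proof.
case: to => to [toI toM] /=; apply: (toI 1).
by rewrite -[RHS]/(to s 1) -toM ?inE // mulg1.
Qed.

(* [to] is a phantom parameter: the group structure depends on it. *)
Definition wreath (A : groupType) (B : finGroupType) (S : choiceType)
    (to : {action B &-> S}) : Type :=
  (B * {fsfun S -> A with 1})%type.

Section Wreath.
Variables (A : groupType) (B : finGroupType) (S : choiceType).
Variable to : {action B &-> S}.

Implicit Types (f g : {fsfun S -> A with 1}) (b c : B) (s : S) (a : A).

Definition base_mul f g : {fsfun S -> A with 1} :=
  [fsfun s in (finsupp f `|` finsupp g)%fset => f s * g s | 1].

Definition base_inv f : {fsfun S -> A with 1} :=
  [fsfun s in finsupp f => (f s)^-1 | 1].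

(* The right translate f^c(s) = f(s c^-1), whose support is (supp f)c. *)
Definition base_act f c : {fsfun S -> A with 1} :=
  [fsfun s in [fset to t c | t in finsupp f]%fset => f (to s c^-1) | 1].

(* The function a^(s). *)
Definition base_single s a : {fsfun S -> A with 1} :=
  [fsfun t in [fset s]%fset => a | 1].

Definition base_one : {fsfun S -> A with 1} := [fsfun with 1].

Lemma base_mulE f g s : base_mul f g s = f s * g s.
Proof.
rewrite fsfunE inE; case: finsuppP => fs /=; last by [].
by case: finsuppP => gs //=; rewrite mulg1.
Qed.

Lemma base_invE f s : base_inv f s = (f s)^-1.
Proof. by rewrite fsfunE; case: finsuppP => fs //; rewrite invg1. Qed.

Lemma base_actE f c s : base_act f c s = f (to s c^-1).
Proof.
rewrite fsfunE; case: ifPn => // /negP sNc.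
case: finsuppP => // sc; case: sNc; apply/imfsetP; exists (to s c^-1) => //=.
by rewrite -total_actM mulVg total_act1.
Qed.

Lemma base_singleE s a t : base_single s a t = if t == s then a else 1.
Proof. by rewrite fsfunE inE. Qed.

Lemma base_oneE s : base_one s = 1.
Proof. by rewrite fsfunE. Qed.

Local Notation W := (wreath A to).

HB.instance Definition _ := Choice.on W.

Definition wreath_one : W := (1, base_one).
Definition wreath_mul (x y : W) : W :=
  (x.1 * y.1, base_mul (base_act x.2 y.1) y.2).
Definition wreath_inv (x : W) : W :=
  (x.1^-1, base_act (base_inv x.2) x.1^-1).

Fact wreath_mulA : associative wreath_mul.
Proof.
move=> [b f] [c g] [d h]; congr pair; first exact: mulgA.
apply/fsfunP => s; rewrite /= !(base_mulE, base_actE) /= mulgA.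
by rewrite invMg total_actM.
Qed.

Fact wreath_mul1 : left_id wreath_one wreath_mul.
Proof.
move=> [b f]; congr pair; first exact: mul1g.
by apply/fsfunP => s; rewrite /= base_mulE base_actE base_oneE mul1g.
Qed.

Fact wreath_mulr1 : right_id wreath_one wreath_mul.
Proof.
move=> [b f]; congr pair; first exact: mulg1.
by apply/fsfunP => s; rewrite /= base_mulE base_actE base_oneE mulg1 invg1 total_act1.
Qed.

Fact wreath_mulV : left_inverse wreath_one wreath_inv wreath_mul.
Proof.
move=> [b f]; congr pair; first exact: mulVg.
apply/fsfunP => s; rewrite /= !(base_mulE, base_actE, base_invE, base_oneE).
by rewrite invgK -total_actM mulVg total_act1 mulVg.
Qed.

Fact wreath_mulrV : right_inverse wreath_one wreath_inv wreath_mul.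
Proof.
move=> [b f]; congr pair; first exact: mulgV.
apply/fsfunP => s; rewrite /= !(base_mulE, base_actE, base_invE, base_oneE).
by rewrite mulgV.
Qed.

HB.instance Definition _ := isGroup.Build W wreath_mulA
  wreath_mul1 wreath_mulr1 wreath_mulV wreath_mulrV.

(* The generators (b, 1) come first, then the generators (1, a^(s0)). *)
Definition wreath_gens nA nB (xA : 'I_nA -> A) (xB : 'I_nB -> B) (s0 : S)
    (i : 'I_(nB + nA)) : W :=
  match split i with
  | inl j => (xB j, base_one)
  | inr k => (1, base_single s0 (xA k))
  end.

End Wreath.

(* Main.v *)
Require Import Defs.
From HB Require Import structures.
From mathcomp Require Import all_boot all_fingroup finmap.
From mathcomp Require Import boolp classical_sets cardinality.

(* For one direction, a and a' are conjugate in A if and only if a^(s0) and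
   a'^(s0) are conjugate in the wreath product, and a word for a^(s0) is computed
   letter by letter from one for a.
   For the other, (b, f) and (c, g) are conjugate if and only if some d satisfies
   b^d = c and some h : S -> A satisfies g(s) = h(s c^-1)^-1 f(s d^-1) h(s) for all
   s.  The second condition says that, along each orbit of c on S, the ordered
   products of f(- d^-1) and of g are conjugate in A.  As B and S are finite, this
   is a finite combination of instances of the conjugacy problem of A. *)

Set Implicit Arguments.
Unset Strict Implicit.
Unset Printing Implicit Defensive.

(** * Total recursive functions *)

(* [F] takes a list, with [nth 0] as access, so that projections and truncations
   need no dependent types; only its values on lists of size [n] matter. *)
Definition computable n (F : seq nat -> nat) : Prop :=
  exists f : rec_fun n, forall v : n.-tuple nat, rec_eval f v (F v).

Definition computable1 (g : nat -> nat) : Prop :=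
  computable 1 (fun v => g (nth 0 v 0)).

Definition computable2 (g : nat -> nat -> nat) : Prop :=
  computable 2 (fun v => g (nth 0 v 0) (nth 0 v 1)).

Definition computable3 (g : nat -> nat -> nat -> nat) : Prop :=
  computable 3 (fun v => g (nth 0 v 0) (nth 0 v 1) (nth 0 v 2)).

Lemma computable_ext n F G :
  computable n F -> (forall v, size v = n -> F v = G v) -> computable n G.
Proof. by move=> [f fP] FG; exists f => v; rewrite -FG ?size_tuple. Qed.

Lemma computable_comp m n F (G : nat -> seq nat -> nat) :
  computable m F -> (forall i, computable n (G i)) ->
  computable n (fun v => F (mkseq (G^~ v) m)).
Proof.
move=> [f fP] GP; have [g gP] := fin_all_exists (fun i : 'I_m => GP i).
exists (RecComp f g) => v /=; exists [tuple G i v | i < m].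
split=> [i|]; first by rewrite tnth_mktuple.
have -> : mkseq (G^~ v) m = [tuple G i v | i < m] 
  by rewrite /mkseq -val_enum_ord -map_comp.
exact: fP.
Qed.

Lemma computable_comp1 n g F :
  computable1 g -> computable n F -> computable n (fun v => g (F v)).
Proof. by move=> gP FP; apply: (computable_comp gP (fun=> FP)). Qed.

Lemma computable_comp2 n g F G :
  computable2 g -> computable n F -> computable n G ->
  computable n (fun v => g (F v) (G v)).
Proof.
move=> gP FP GP.
by apply: (computable_comp (G := fun i => if i is 0 then F else G) gP); case.
Qed.

Lemma computable_comp3 n g F G H :
  computable3 g -> computable n F -> computable n G -> computable n H ->
  computable n (fun v => g (F v) (G v) (H v)).
Proof.
move=> gP FP GP HP; apply: (computable_comp (G := fun i =>
  match i with 0 => F | 1 => G | _ => H end) gP).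
by case=> [|[]].
Qed.

Lemma computable0 n : computable n (fun=> 0).
Proof.
have: computable 0 (fun=> 0) by exists RecZero.
(* [RecZero] is nullary; in positive arity it is composed with the empty family, which
   [RecProj ord0] fills vacuously. *)
by move/(@computable_comp 0 n _ (fun _ _ => 0)); apply; case: n => [|n] _;
  [exists RecZero | exists (RecComp RecZero (fun i => RecProj ord0)) => v /=;
   exists [tuple]; split=> // -[]].
Qed.

Lemma computable_nth n i : computable n (fun v => nth 0 v i).
Proof.
case: (ltnP i n) => [lt_in | le_ni].
  by exists (RecProj (Ordinal lt_in)) => v /=; rewrite (tnth_nth 0).
by apply: (computable_ext (computable0 n)) => v sv; rewrite nth_default ?sv.
Qed.

Lemma computable_succ : computable1 succn.
Proof. by exists RecSucc => v /=; rewrite /thead (tnth_nth 0). Qed.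

Lemma computable_const n c : computable n (fun=> c).
Proof.
by elim: c => [|c IHc]; [exact: computable0 | exact: computable_comp1 computable_succ IHc].
Qed.

(** In the step of a recursion the parameters come after the counter and the previous value; this
    shifts functions of the parameters into place. *)
Lemma computable_drop n k F :
  computable n F -> computable (k + n) (fun v => F (drop k v)).
Proof.
move=> FP; apply: computable_ext (computable_comp FP (fun i => computable_nth _ (k + i))) _.
move=> v sv; congr F; apply: (@eq_from_nth _ 0) => [|i].
  by rewrite size_mkseq size_drop sv addKn.
by rewrite size_mkseq => lt_in; rewrite nth_mkseq // nth_drop.
Qed.

Lemma computable_nat_rect n F0 N step :
  computable n F0 -> computable n N ->
  computable n.+2 (fun v => step (nth 0 v 0) (nth 0 v 1) (drop 2 v)) ->
  computable n (fun v => nat_rect (fun=> nat) (F0 v) (fun k r => step k r v) (N v)).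
Proof.
move=> [f0 f0P] NP [g gP].
have HP : computable n.+1 (fun v =>
    nat_rect (fun=> nat) (F0 (behead v)) (fun k r => step k r (behead v)) (head 0 v)).
  exists (RecPrim f0 g) => v /=.
  set R := fun k => nat_rect (fun=> nat) (F0 (behead v)) (fun k r => step k r (behead v)) k.
  exists R; split=> [|k _|].
  - exact: (f0P [tuple of behead v]).
  - by have := gP [tuple of k :: R k :: behead v]; rewrite /= drop0.
  - by rewrite /R; case: v {R} => -[|x v] //= ?; rewrite /thead (tnth_nth 0).
(* [RecPrim] recurses on its first argument, so the bound [N v] is put in front of the
   parameters. *)
pose G i := if i is j.+1 then fun v => nth 0 v j else N.
apply: computable_ext (computable_comp (G := G) HP _) _.
  by case=> [|i] //=; apply: computable_nth.
move=> v sv /=.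
have -> : [seq G i v | i <- iota 1 n] = v; last by [].
apply: (@eq_from_nth _ 0) => [|i]; rewrite size_map size_iota // => lt_in.
by rewrite (nth_map 0) ?size_iota // nth_iota.
Qed.

(** Recursion on the truth value: zero steps return [G v], one step returns [F v]. *)
Lemma computable_if n (P : seq nat -> bool) F G :
  computable n (fun v => P v) -> computable n F -> computable n G ->
  computable n (fun v => if P v then F v else G v).
Proof.
move=> PP FP GP.
have st := @computable_drop n 2 _ FP.
apply: computable_ext (computable_nat_rect (step := fun _ _ v => F v) GP PP st) _.
by move=> v _; case: (P v).
Qed.

Lemma computable_add : computable2 addn.
Proof.
apply: computable_ext (computable_nat_rect (step := fun _ r _ => r.+1)
  (computable_nth 2 1) (computable_nth 2 0) _) _.
  exact: computable_comp1 computable_succ (computable_nth _ _).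
by move=> v _ /=; elim: (nth 0 v 0) => //= k ->.
Qed.

Lemma computable_mul : computable2 muln.
Proof.
apply: computable_ext (computable_nat_rect (step := fun _ r v => nth 0 v 1 + r)
  (computable0 2) (computable_nth 2 0) _) _.
  apply: (computable_comp2 computable_add); last exact: computable_nth.
  exact: (@computable_drop 2 2 _ (computable_nth 2 1)).
by move=> v _ /=; elim: (nth 0 v 0) => //= k ->; rewrite mulSn.
Qed.

Lemma computable_pred : computable1 predn.
Proof.
apply: computable_ext (computable_nat_rect (step := fun k _ _ => k)
  (computable0 1) (computable_nth 1 0) (computable_nth 3 0)) _.
by move=> v _; case: (nth 0 v 0).
Qed.

Lemma computable_sub : computable2 subn.
Proof.
apply: computable_ext (computable_nat_rect (step := fun _ r _ => r.-1)
  (computable_nth 2 0) (computable_nth 2 1) _) _.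
  exact: computable_comp1 computable_pred (computable_nth _ _).
by move=> v _ /=; elim: (nth 0 v 1) => [|k IHk]; rewrite ?subn0 // subnS -IHk.
Qed.

Lemma computable_eq0 n F : computable n F -> computable n (fun v => F v == 0).
Proof.
move=> FP; apply: computable_ext (computable_nat_rect (step := fun _ _ _ => 0)
  (computable_const n 1) FP (computable0 _)) _.
by move=> v _; case: (F v).
Qed.

Lemma computable_leq n F G :
  computable n F -> computable n G -> computable n (fun v => F v <= G v).
Proof. by move=> FP GP; apply: computable_eq0 (computable_comp2 computable_sub FP GP). Qed.

Lemma computable_eqn n F G :
  computable n F -> computable n G -> computable n (fun v => F v == G v).
Proof.
move=> FP GP; apply: (computable_ext (F := fun v =>
  if F v <= G v then (G v <= F v : nat) else 0)).
  by apply: computable_if; try exact: computable_leq; exact: computable0.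
by move=> v _; rewrite eqn_leq; case: (_ <= _).
Qed.

Lemma computable_and n (P Q : seq nat -> bool) :
  computable n (fun v => P v) -> computable n (fun v => Q v) ->
  computable n (fun v => P v && Q v).
Proof.
move=> PP QP; apply: computable_ext (computable_if PP QP (computable0 n)) _.
by move=> v _; case: (P v).
Qed.

Lemma computable_exists n (D : finType) (P : D -> seq nat -> bool) :
  (forall d, computable n (fun v => P d v)) ->
  computable n (fun v => [exists d, P d v]).
Proof.
move=> PP; apply: (computable_ext (F := fun v => has (P^~ v) (enum D))).
  elim: (enum D) => [|d s IHs] /=; first exact: computable0.
  apply: computable_ext (computable_if (PP d) (computable_const n 1) IHs) _.
  by move=> v _; case: (P d v).
move=> v _; congr (nat_of_bool _); apply/hasP/existsP => [[d _ Pd]|[d Pd]]; exists d => //.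
by rewrite mem_enum.
Qed.

Lemma computable_forall n (D : finType) (P : D -> seq nat -> bool) :
  (forall d, computable n (fun v => P d v)) ->
  computable n (fun v => [forall d, P d v]).
Proof.
move=> PP; apply: (computable_ext (F := fun v => all (P^~ v) (enum D))).
  elim: (enum D) => [|d s IHs] /=; first exact: computable_const.
  exact: computable_and.
move=> v _; congr (nat_of_bool _); apply/allP/forallP => [Pd d|Pd d _]; last exact: Pd.
by apply: Pd; rewrite mem_enum.
Qed.

(* Bounded case analysis: [G] need not be uniformly computable in its index. *)
Lemma computable_cases n N F (G : nat -> seq nat -> nat) :
  computable n F -> (forall i, computable n (G i)) ->
  computable n (fun v => if F v < N then G (F v) v else 0).
Proof.
move=> FP GP; elim: N => [|N IHN]; first exact: computable0.
apply: computable_ext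
  (computable_if (computable_eqn FP (computable_const n N)) (GP N) IHN) _.
by move=> v _; rewrite ltnS [F v <= N]leq_eqVlt; case: (F v =P N) => [->|].
Qed.

(** [g] is arbitrary: finitely many values form a case distinction between constants. The
    multiplication and the action of the finite group [B] enter the algorithms this way. *)
Lemma computable_table N g : computable1 (fun x => if x < N then g x else 0).
Proof.
exact: (@computable_cases 1 N _ (fun i _ => g i) (computable_nth 1 0)
  (fun i => computable_const 1 (g i))).
Qed.

Lemma computable_table2 M N g :
  computable2 (fun x y => if x < M then if y < N then g x y else 0 else 0).
Proof.
apply: (@computable_cases 2 M (fun v => nth 0 v 0) (fun i v => if nth 0 v 1 < N then g i (nth 0 v 1) else 0)).
  exact: computable_nth.
by move=> i; apply: (computable_comp1 (computable_table N (g i))); apply: computable_nth.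
Qed.

Lemma computable_modn d : 0 < d -> computable1 (modn^~ d).
Proof.
move=> d_gt0; apply: computable_ext (computable_nat_rect
  (step := fun _ r _ => if r.+1 == d then 0 else r.+1)
  (computable0 1) (computable_nth 1 0) _) _.
  have sP := computable_comp1 computable_succ (computable_nth 3 1).
  exact: computable_if (computable_eqn sP (computable_const _ d)) (computable0 _) sP.
move=> v _ /=; elim: (nth 0 v 0) => [|k /= IHk] /=; first by rewrite mod0n.
rewrite {}IHk modnS /dvdn -[k.+1]addn1 -modnDml addn1.
have := ltn_pmod k d_gt0; rewrite leq_eqVlt.
by case: ((k %% d).+1 =P d) => [->|_] /= lt; [rewrite modnn | rewrite (modn_small lt)].
Qed.

(** The quotient grows by one exactly when the counter reaches a multiple of [d]. *)
Lemma computable_divn d : 0 < d -> computable1 (divn^~ d).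
Proof.
move=> d_gt0; apply: computable_ext (computable_nat_rect
  (step := fun k r _ => (k.+1 %% d == 0) + r)
  (computable0 1) (computable_nth 1 0) _) _.
  apply: computable_comp2 computable_add _ (computable_nth 3 1).
  apply: computable_eq0; apply: (computable_comp1 (computable_modn d_gt0)).
  exact: computable_comp1 computable_succ (computable_nth 3 0).
move=> v _ /=; elim: (nth 0 v 0) => [|k /= IHk] /=; first by rewrite div0n.
by rewrite IHk divnS.
Qed.

Lemma computable_foldr n (I : Type) g (F : I -> seq nat -> nat) z (s : seq I) :
  computable2 g -> (forall i, computable n (F i)) ->
  computable n (fun v => foldr (fun i x => g (F i v) x) z s).
Proof.
move=> gP FP; elim: s => [|i s IHs] /=; first exact: computable_const.
exact: computable_comp2.
Qed.

(** * Coding of words by natural numbers *)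

Section Words.
Variable n : nat.
Hypothesis n_gt0 : 0 < n.
Implicit Types (w : word n) (l : letter n).

Definition code_head (c : nat) : nat := c.-1 %% n.*2.
(** At 0 the value is 0, so that iterating past the end of a word stays at the empty word. *)
Definition code_tail (c : nat) : nat := c.-1 %/ n.*2.

Lemma code_head_cons l w : code_head (word_code (l :: w)) = letter_code l.
Proof.
by rewrite /code_head /= addnC mulnC modnMDl modn_small ?letter_code_lt.
Qed.

Lemma code_tail_cons l w : code_tail (word_code (l :: w)) = word_code w.
Proof.
rewrite /code_tail /= addnC mulnC divnMDl ?double_gt0 //.
by rewrite divn_small ?letter_code_lt ?addn0.
Qed.

Lemma iter_code_tail w k : iter k code_tail (word_code w) = word_code (drop k w).
Proof.
elim: k w => [|k IHk] [|l w]; rewrite ?drop0 // iterSr.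
  by rewrite [code_tail _]div0n (IHk [::]).
by rewrite code_tail_cons IHk.
Qed.

(** Lets a recursion on a word run for as many stages as its code, without computing its length. *)
Lemma size_le_word_code w : size w <= word_code w.
Proof.
elim: w => //= l w IHw; rewrite ltnS (leq_trans IHw) //.
by rewrite (leq_trans _ (leq_addl _ _)) // leq_pmull // double_gt0.
Qed.

(** Makes a decision procedure, which is specified on codes only, total on all pairs of naturals. *)
Lemma word_code_surj c : exists w, word_code w = c.
Proof.
elim/ltn_ind: c => -[|c] IHc; first by exists [::].
have q_gt0 : 0 < n.*2 by rewrite double_gt0.
have [|w wE] := IHc (c %/ n.*2); first by rewrite ltnS leq_div.
have lt : (c %% n.*2)./2 < n by rewrite ltn_half_double ltn_pmod.
exists ((Ordinal lt, odd (c %% n.*2)) :: w); rewrite /= wE /letter_code /=.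
by rewrite [_.*2 + _]addnC odd_double_half mulnC addnC -divn_eq.
Qed.

(** The step also receives the code of the suffix: [lamp_word] treats a letter according to the [B]
    component of the suffix. *)
Fixpoint word_rec (step : nat -> nat -> nat -> nat) (z : nat) w : nat :=
  if w is l :: w' then step (letter_code l) (word_code w') (word_rec step z w')
  else z.

Lemma computable_word_rec step :
  computable3 step ->
  exists2 g, computable2 g & forall w z, g (word_code w) z = word_rec step z w.
Proof.
move=> stP.
(* Letters are absorbed from the last one to the first: stage [k] has treated the
   suffix reached after [c - k] steps, where [c] bounds the length of the word. *)
pose body c k r := let s := iter (c - k.+1) code_tail c in
  if s == 0 then r else step (code_head s) (code_tail s) r.
exists (fun c z => nat_rect (fun=> nat) z (body c) c).
  apply: (computable_nat_rect (step := fun k r v => body (nth 0 v 0) k r));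
    try exact: computable_nth.
  have q_gt0 : 0 < n.*2 by rewrite double_gt0.
  have tlP m F : computable m F -> computable m (fun v => code_tail (F v)).
    move=> FP; apply: (computable_comp1 (computable_divn q_gt0)).
    exact: computable_comp1 computable_pred FP.
  have hdP m F : computable m F -> computable m (fun v => code_head (F v)).
    move=> FP; apply: (computable_comp1 (computable_modn q_gt0)).
    exact: computable_comp1 computable_pred FP.
  have itP : computable2 (fun k c => iter k code_tail c).
    apply: computable_ext (computable_nat_rect (step := fun _ r _ => code_tail r)
      (computable_nth 2 1) (computable_nth 2 0) (tlP _ _ (computable_nth 4 1))) _.
    by move=> v _; elim: (nth 0 v 0) => //= k ->.
  have sP : computable 4 (fun v =>
      iter (nth 0 (drop 2 v) 0 - (nth 0 v 0).+1) code_tail (nth 0 (drop 2 v) 0)).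
    have cP := @computable_drop 2 2 _ (computable_nth 2 0).
    apply: (computable_comp2 itP _ cP); apply: (computable_comp2 computable_sub cP).
    exact: computable_comp1 computable_succ (computable_nth _ _).
  apply: (computable_if (computable_eq0 sP) (computable_nth _ _)).
  exact: (computable_comp3 stP (hdP _ _ sP) (tlP _ _ sP) (computable_nth _ _)).
move=> w z; set c := word_code w.
have main k : k <= c ->
    nat_rect (fun=> nat) z (body c) k = word_rec step z (drop (c - k) w).
  elim: k => [_|k IHk lt_kc] /=; first by rewrite subn0 drop_oversize ?size_le_word_code.
  rewrite IHk 1?ltnW // /body iter_code_tail -/c.
  have -> : drop (c - k) w = behead (drop (c - k.+1) w).
    by rewrite -drop1 drop_drop add1n subnSK.
  (* The code may exceed the length of the word; the first stages see the empty suffix, of code 0,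
     and change nothing. *)
  case: (drop _ w) => [|l w'] //.
  by rewrite code_head_cons code_tail_cons.
by rewrite main // subnn drop0.
Qed.

Lemma computable_cat :
  exists2 g, computable2 g &
    forall u v : word n, g (word_code u) (word_code v) = word_code (u ++ v).
Proof.
pose step (c _ r : nat) := (c + n.*2 * r).+1.
have stP : computable3 step.
  apply: (computable_comp1 computable_succ).
  apply: (computable_comp2 computable_add); first exact: computable_nth.
  by apply: (computable_comp2 computable_mul); [exact: computable_const | exact: computable_nth].
have [g gP gE] := computable_word_rec stP; exists g => // u v.
by rewrite gE; elim: u => //= l u ->.
Qed.

(** Every pair of naturals codes two words and [P] either holds or fails, so the given program halts
    everywhere with value 0 or 1 and itself computes [D]. A total [D] can be composed with other
    computable functions. *)
Lemma decidable_words2P (P : word n -> word n -> Prop) :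
  decidable_words2 P <-> exists2 D : nat -> nat -> bool,
    computable2 (fun c d => D c d) &
    forall u v : word n, P u v <-> D (word_code u) (word_code v).
Proof.
split=> [[f fP]|[D [f fP] DE]]; last first.
  exists f => u v; have := fP [tuple word_code u; word_code v]; rewrite /=.
  case Duv: (D _ _) => fE; split=> //.
    by move=> nP; case: nP; apply/DE.
  by move/DE; rewrite Duv.
exists (fun c d => `[< rec_eval f [tuple c; d] 1 >]).
  exists f => v; rewrite (_ : v = [tuple nth 0 v 0; nth 0 v 1]) /=; last first.
    by apply: val_inj; case: v => -[|a [|b []]].
  have [u <-] := word_code_surj (nth 0 v 0); have [u' <-] := word_code_surj (nth 0 v 1).
  have [fT fF] := fP u u'.
  have [/fT fE|/fF fE] := pselect (P u u').
    by have -> : `[< rec_eval f [tuple word_code u; word_code u'] 1 >] by apply/asboolP.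
  case: asboolP => //.
move=> u v; have [fT fF] := fP u v.
split=> [/fT/asboolP//|/asboolP fE].
by apply: contrapT => /fF/rec_eval_fun-/(_ _ fE).
Qed.

End Words.

Local Open Scope group_scope.

(** * Conjugacy in the wreath product *)

Section TwistedConjugacy.
Variables (A : groupType) (T : finType) (p : T -> T) (f g : T -> A).
Hypothesis p_inj : injective p.

(** The relation telescopes along an orbit, and one full turn returns [h] to its initial value.
    Conversely, a conjugator at one point of a cycle is propagated along the cycle by the
    relation. *)
Lemma twisted_conjugacyP :
  (exists h : T -> A, forall t, g t = (h t)^-1 * f t * h (p t)) <->
  forall t, are_conjugate (\prod_(s <- fingraph.orbit p t) f s) (\prod_(s <- fingraph.orbit p t) g s).
Proof.
split=> [[h gE] t|fg].
  have main i : \prod_(s <- traject p t i) g s =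
      (h t)^-1 * \prod_(s <- traject p t i) f s * h (iter i p t).
    elim: i => [|i IHi]; first by rewrite !big_nil mulg1 mulVg.
    rewrite trajectSr -cats1 !big_cat !big_seq1 /= {}IHi gE.
    by rewrite -iterS !mulgA mulgK.
  by exists (h t); rewrite /fingraph.orbit main iter_order // conjgE mulgA.
have [k kE] := choice fg.
(* [E r i] must be the value of [h] at [iter i p r]; conjugacy of the products over
   the orbit of [r] says that it depends on [i] only modulo the orbit's length. *)
pose E r i := (\prod_(s <- traject p r i) f s)^-1 * k r * \prod_(s <- traject p r i) g s.
have E_S r i : E r i.+1 = (f (iter i p r))^-1 * E r i * g (iter i p r).
  by rewrite /E trajectSr -cats1 !big_cat !big_seq1 /= invgM !mulgA.
have E_order r : E r (fingraph.order p r) = E r 0.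
  rewrite /E /= !big_nil mulg1 invg1 mul1g -/(fingraph.orbit p r) -kE conjgE.
  by rewrite -!mulgA mulVKg mulKg.
(* [froot] chooses one starting point on each cycle, and [findex] counts the steps from it. *)
exists (fun t => E (froot p t) (findex p (froot p t) t)) => t.
have pt : froot p (p t) = froot p t.
  by apply/esym/(fingraph.rootP (fconnect_sym p_inj)); apply: fconnect1.
rewrite pt; set r := froot p t; set i := findex p r t.
have rt : fconnect p r t by rewrite fconnect_sym // connect_root.
have it : iter i p r = t by apply: iter_findex.
have -> : E r (findex p r (p t)) = E r i.+1.
  (* If [t] is the last point of the cycle, [p t] is [r] again and [E_order] applies; otherwise the
     index increases by one. *)
  have := findex_max rt; rewrite -/i leq_eqVlt -it -iterS => /predU1P[->|lt].
    by rewrite iter_order // findex0 E_order.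
  by rewrite findex_iter.
by rewrite E_S it; clearbody E; rewrite !mulgA mulgK mulVg mul1g.
Qed.

End TwistedConjugacy.

Section WreathConjugacy.
Variables (A : groupType) (B : finGroupType) (S : choiceType).
Variable to : {action B &-> S}.
Variables (T : finType) (phi : T -> S) (psi : S -> T).
Hypotheses (phiK : cancel phi psi) (psiK : cancel psi phi).
Implicit Types x y : wreath A to.

(* [T] is a copy of [S]: the orbit theory of [fingraph] needs a [finType]. *)
Definition translate (c : B) (t : T) : T := psi (to (phi t) c).

Lemma translateK c : cancel (translate c) (translate c^-1).
Proof. by move=> t; rewrite /translate psiK -total_actM mulgV total_act1 phiK. Qed.

(** The inverse of [(d, h)] carries a translation by [d^-1]; the later factors translate it by
    [x.1 * d], which makes [x.1 ^ d] in total. *)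
Lemma wreath_conjE x (d : B) (h : {fsfun S -> A with 1}) s :
  (x ^ ((d, h) : wreath A to)).2 s =
  (h (to s (x.1 ^ d)^-1))^-1 * x.2 (to s d^-1) * h s.
Proof.
rewrite conjgE -[LHS]/((wreath_mul (wreath_inv (d, h)) (wreath_mul x (d, h))).2 s) /=.
rewrite !base_mulE !base_actE base_invE mulgA.
by rewrite -total_actM conjgE [in RHS]invgM.
Qed.

Lemma wreath_conjugateP x y :
  are_conjugate x y <-> exists d : B, x.1 ^ d = y.1 /\ forall t,
    are_conjugate (\prod_(s <- fingraph.orbit (translate y.1) t) x.2 (to (phi s) d^-1))
      (\prod_(s <- fingraph.orbit (translate y.1) t) y.2 (phi s)).
Proof.
split=> [[[d h] xy]|[d [xd fg]]].
  have xd : x.1 ^ d = y.1 by rewrite -xy conjgE.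
  exists d; split=> //.
  apply/(twisted_conjugacyP _ _ (can_inj (translateK _))).
  (* Twisted conjugacy pairs [t] with its image under [y.1], whereas [wreath_conjE] pairs [s] with
     its preimage, so [h] is read one step back. *)
  exists (fun t => h (to (phi t) (y.1)^-1)) => t.
  rewrite /translate psiK -total_actM mulgV total_act1 -xd.
  by rewrite -wreath_conjE xy.
have [h gE] := (twisted_conjugacyP _ _ (can_inj (translateK y.1))).2 fg.
(* The inverse shift; the image of the finite type [T] bounds the support. *)
pose h' : {fsfun S -> A with 1} :=
  [fsfun s in [fset phi t | t in T]%fset => h (translate y.1 (psi s)) | 1].
have h'E s : h' s = h (translate y.1 (psi s)).
  rewrite fsfunE; case: ifPn => // /negP[]; apply/imfsetP; exists (psi s) => //.
exists (d, h'); rewrite [LHS]surjective_pairing [RHS]surjective_pairing; congr pair.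
  by rewrite -xd conjgE.
apply/fsfunP => s; rewrite wreath_conjE !h'E xd /translate psiK -total_actM mulVg.
by rewrite total_act1; have := gE (psi s); rewrite /translate !psiK => ->.
Qed.

End WreathConjugacy.

(** * Words over the generators of the wreath product *)

Definition letter_val (G : groupType) n (x : 'I_n -> G) (l : letter n) : G :=
  if l.2 then (x l.1)^-1 else x l.1.

Lemma word_val_cons (G : groupType) n (x : 'I_n -> G) l w :
  word_val x (l :: w) = letter_val x l * word_val x w.
Proof. by rewrite /word_val big_cons. Qed.

Lemma word_val_flatten (G : groupType) n (x : 'I_n -> G) (I : Type)
    (W : I -> word n) s :
  word_val x (flatten (map W s)) = \prod_(i <- s) word_val x (W i).
Proof.
elim: s => [|i s IHs] /=; first by rewrite /word_val !big_nil.
by rewrite big_cons -IHs /word_val big_cat.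
Qed.

Section WreathWords.
Variables (A : groupType) (B : finGroupType) (S : choiceType).
Variable to : {action B &-> S}.
Variables (nA nB : nat) (xA : 'I_nA -> A) (xB : 'I_nB -> B) (s0 : S).

Local Notation gens := (wreath_gens to xA xB s0).

Lemma base_invS (a : A) : base_inv (base_single s0 a) = base_single s0 a^-1.
Proof.
apply/fsfunP => s; rewrite base_invE !base_singleE.
by case: eqP => // _; rewrite invg1.
Qed.

Lemma base_act1 (f : {fsfun S -> A with 1}) : base_act to f 1 = f.
Proof. by apply/fsfunP => s; rewrite base_actE invg1 total_act1. Qed.

Lemma base_single1 : base_single s0 (1 : A) = @base_one A S.
Proof. by apply/fsfunP => s; rewrite base_singleE base_oneE if_same. Qed.

Lemma base_mulS (a b : A) :
  base_mul (base_single s0 a) (base_single s0 b) = base_single s0 (a * b).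
Proof.
apply/fsfunP => s; rewrite base_mulE !base_singleE.
by case: eqP => // _; rewrite mulg1.
Qed.

Lemma lamp_letterE l s :
  (letter_val gens l).2 s =
  if split l.1 is inr k then base_single s0 (letter_val xA (k, l.2)) s else 1.
Proof.
case: l => i e; rewrite /letter_val /wreath_gens /=; case: (split i) => k /=.
  case: e; last by rewrite base_oneE.
  by rewrite [LHS]base_actE base_invE base_oneE invg1.
by case: e => //; rewrite [LHS]base_actE invg1 invg1 total_act1 base_invS.
Qed.

Lemma base_letterE l :
  (letter_val gens l).1 = if split l.1 is inl j then letter_val xB (j, l.2) else 1.
Proof.
case: l => i e; rewrite /letter_val /wreath_gens /=; case: (split i) => k /=.
  by case: e.
by case: e => //; rewrite -[LHS]/(1^-1) invg1.
Qed.

(* Prepending [a^(s0)] to (b, f) multiplies f by [a] at [s0 b] only, and prepending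
   an element of [B] leaves f unchanged. *)
Fixpoint lamp_word (s : S) (w : word (nB + nA)) : word nA :=
  if w is l :: w' then
    if split l.1 is inr k then
      if s == to s0 (word_val gens w').1 then (k, l.2) :: lamp_word s w'
      else lamp_word s w'
    else lamp_word s w'
  else [::].

Lemma lamp_wordE s w : (word_val gens w).2 s = word_val xA (lamp_word s w).
Proof.
elim: w => [|l w IHw]; first by rewrite /word_val !big_nil [LHS]base_oneE.
rewrite word_val_cons [LHS]base_mulE base_actE lamp_letterE IHw /=.
case: (split l.1) => k; first by rewrite mul1g.
rewrite base_singleE; set b := (word_val gens w).1.
have -> : (to s b^-1 == s0) = (s == to s0 b).
  apply/eqP/eqP => [<-|->]; last by rewrite -total_actM mulgV total_act1.
  by rewrite -total_actM mulVg total_act1.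
by case: eqP; rewrite ?mul1g // word_val_cons.
Qed.

Definition lamp_embed (w : word nA) : word (nB + nA) :=
  [seq (rshift nB l.1, l.2) | l <- w].

Lemma lamp_embedE w :
  word_val gens (lamp_embed w) = (1, base_single s0 (word_val xA w)).
Proof.
elim: w => [|[k e] w IHw] /=; first by rewrite /word_val !big_nil base_single1.
rewrite !word_val_cons IHw [LHS]surjective_pairing; congr pair.
  by rewrite -[LHS]/(_.1 * 1) mulg1 base_letterE /= (unsplitK (inr k)).
rewrite -[LHS]/(base_mul (base_act to _ 1) _) base_act1 -base_mulS; congr base_mul.
by apply/fsfunP => s; rewrite lamp_letterE /= (unsplitK (inr k)).
Qed.

(** If the component [d] of the conjugator fixes [s0], the values at [s0] are conjugate. Otherwise
    the value at [s0] gives [b = 1], and the value at [to s0 d] shows that [a] is conjugate to 1. *)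
Lemma base_single_conjugate (a b : A) :
  are_conjugate ((1, base_single s0 a) : wreath A to) (1, base_single s0 b) <->
  are_conjugate a b.
Proof.
split=> [[[d h] ab]|[k ab]]; last first.
  exists (1, base_single s0 k); rewrite [LHS]surjective_pairing; congr pair.
    by rewrite conjgE -[LHS]/(1^-1 * (1 * 1)) !mulg1 invg1.
  apply/fsfunP => s; rewrite wreath_conjE /= conj1g invg1 !total_act1.
  by rewrite !base_singleE; case: eqP => _; rewrite ?mulg1 ?invg1 // -ab conjgE mulgA.
have abE s : base_single s0 b s = base_single s0 a (to s d^-1) ^ h s.
  have := wreath_conjE ((1, base_single s0 a) : wreath A to) d h s.
  by rewrite ab /= conj1g invg1 total_act1 conjgE mulgA.
have := abE s0; rewrite !base_singleE eqxx.
case: eqP => [_ ->|sd]; first by exists (h s0).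
rewrite conj1g => ->; have := abE (to s0 d).
rewrite -total_actM mulgV total_act1 !base_singleE eqxx.
case: eqP => [s0d|_ a1]; first by case: sd; rewrite -[in LHS]s0d -total_actM mulgV total_act1.
by exists (h (to s0 d)).
Qed.

(** * Computing both components of a word on codes *)

Section Codes.
Hypothesis nA_gt0 : 0 < nA.

Let n_gt0 : 0 < nB + nA. Proof. exact: ltn_addl. Qed.

Lemma computable_lamp_embed :
  exists2 g, computable1 g & forall w, g (word_code w) = word_code (lamp_embed w).
Proof.
(* The shift of indices by [nB] adds [nB.*2] to a letter code, and the base of numeration becomes
   that of the larger alphabet. *)
pose step (c _ r : nat) := (c + nB.*2 + (nB + nA).*2 * r).+1%N.
have stP : computable3 step.
  apply: (computable_comp1 computable_succ); apply: (computable_comp2 computable_add).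
    exact: (computable_comp2 computable_add (computable_nth _ _) (computable_const _ _)).
  exact: (computable_comp2 computable_mul (computable_const _ _) (computable_nth _ _)).
have [g gP gE] := computable_word_rec nA_gt0 stP.
exists (g^~ 0); first exact: (computable_comp2 gP (computable_nth _ _) (computable0 _)).
move=> w; rewrite gE; elim: w => //= l w ->.
by congr (_ + _).+1; rewrite /letter_code /= doubleD addnC addnA.
Qed.

(** Elements of [B] are represented by their ranks in [enum B], on which multiplication by a letter
    is a finite table. The defaults 0 are never met on codes of words. *)
Lemma computable_base_part :
  exists2 g, computable1 g &
    forall w, g (word_code w) = enum_rank (word_val gens w).1.
Proof.
pose mulc (c r : nat) : nat :=
  if [pick l | letter_code l == c] is Some l then
    enum_rank ((letter_val gens l).1 * nth 1 (enum B) r)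
  else 0.
pose step c (_ : nat) r :=
  if (c < (nB + nA).*2)%N then if (r < #|B|)%N then mulc c r else 0 else 0.
have stP : computable3 step.
  exact: (computable_comp2 (computable_table2 _ _ mulc) (computable_nth _ _) (computable_nth _ _)).
have [g gP gE] := computable_word_rec n_gt0 stP.
exists (g^~ (enum_rank (1 : B))).
  exact: (computable_comp2 gP (computable_nth _ _) (computable_const _ _)).
move=> w; rewrite gE; elim: w => [|l w IHw] /=; first by rewrite /word_val big_nil.
rewrite /step letter_code_lt IHw ltn_ord /mulc.
case: pickP => [l' /eqP/letter_code_inj ->|/(_ l)]; last by rewrite eqxx.
by rewrite nth_enum_rank word_val_cons.
Qed.

Lemma computable_lamp_word s :
  exists2 g, computable1 g &
    forall w, g (word_code w) = word_code (lamp_word s w).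
Proof.
have [gb gbP gbE] := computable_base_part.
pose hit (r : nat) : nat := s == to s0 (nth 1 (enum B) r).
pose tbl r := if (r < #|B|)%N then hit r else 0.
(* Codes from [nB.*2] on belong to the generators of [A]; subtracting [nB.*2] gives the code in the
   smaller alphabet. *)
pose step c d r :=
  if (nB.*2 <= c) && (0 < tbl (gb d)) then (c - nB.*2 + nA.*2 * r).+1 else r.
have stP : computable3 step.
  apply: computable_if (computable_nth _ _).
    apply: computable_and; apply: computable_leq; try exact: computable_const.
      exact: computable_nth.
    apply: (computable_comp1 (computable_table _ hit)).
    exact: (computable_comp1 gbP (computable_nth _ _)).
  apply: (computable_comp1 computable_succ); apply: (computable_comp2 computable_add).
    exact: (computable_comp2 computable_sub (computable_nth _ _) (computable_const _ _)).
  exact: (computable_comp2 computable_mul (computable_const _ _) (computable_nth _ _)).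
have [g gP gE] := computable_word_rec n_gt0 stP.
exists (g^~ 0); first exact: (computable_comp2 gP (computable_nth _ _) (computable0 _)).
move=> w; rewrite gE; elim: w => [|l w IHw] //=.
rewrite {}IHw /step gbE /tbl ltn_ord /hit nth_enum_rank lt0b.
case: l => i e; rewrite /letter_code /=.
rewrite -(splitK i); case: (split i) => k; rewrite unsplitK /=.
  by rewrite leqNgt (@letter_code_lt nB (k, e)).
rewrite doubleD -addnA leq_addr addKn /=.
by case: eqP.
Qed.

End Codes.
End WreathWords.

Theorem corollary1p0p6
    (A : groupType) (B : finGroupType)
    (nA nB : nat) (xA : 'I_nA -> A) (xB : 'I_nB -> B)
    (S : choiceType) (to : {action B &-> S}) (s0 : S)
    (A_presented : recursively_presented xA)
    (B_presented : recursively_presented xB)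
    (A_nontrivial : nontrivial A)
    (B_nontrivial : nontrivial B)
    (A_classes : infinite_set (conj_classes A))
    (to_transitive : transitive_action to) :
  conjugacy_problem_solvable (wreath_gens to xA xB s0) <->
  conjugacy_problem_solvable xA.
Proof.
(* The numeration of words is onto only over a nonempty alphabet; without generators [A] would be
   trivial. *)
have nA_gt0 : (0 < nA)%N.
  rewrite lt0n; apply/eqP => nA0; have [R [_ [genA _]]] := A_presented.
  have [g] := A_nontrivial; apply; have [w <-] := genA g.
  rewrite /word_val; case: w => [|[[i lt_i] e] w]; first by rewrite big_nil.
  by exfalso; move: lt_i; rewrite nA0.
have n_gt0 : (0 < nB + nA)%N by apply: ltn_addl.
rewrite /conjugacy_problem_solvable !decidable_words2P //; split=> [] [D DP DE].
  have [g gP gE] := computable_lamp_embed nB nA_gt0.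
  exists (fun c d => D (g c) (g d)) => [|u v].
    by apply: (computable_comp2 DP); apply: (computable_comp1 gP); apply: computable_nth.
  by rewrite !gE -DE !lamp_embedE base_single_conjugate.
(* By transitivity the orbit of [s0] is all of [S], which is therefore finite; [seq_sub pts] is its
   copy as a [finType]. *)
pose pts := [seq to s0 b | b <- enum B].
have ptsP s : s \in pts.
  by have [b <-] := to_transitive s0 s; apply: map_f; rewrite mem_enum.
pose psi s : seq_sub pts := SeqSub (ptsP s).
have psiK : cancel psi val by [].
have phiK : cancel val psi by move=> t; apply: val_inj.
have [gb gbP gbE] := computable_base_part to xA xB s0 nA_gt0.
have /choice[gl glP] : forall s, exists g, computable1 g /\
    forall w, g (word_code w) = word_code (lamp_word to xA xB s0 s w).
  by move=> s; have [g] := computable_lamp_word to xA xB s0 nA_gt0 s; exists g.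
have [cat catP catE] := computable_cat nA_gt0.
(* On the code of a word this is the code of a word over the generators of [A] for the ordered
   product along the orbit; the base case 0 codes the empty word. *)
pose prod_code (d b : B) t c :=
  foldr (fun s x => cat (gl (to (val s) d^-1) c) x) 0 (fingraph.orbit (translate to val psi b) t).
(* [b] is a guess for the base component of the first word: with [b] and [d] fixed, the orbits to
   multiply along no longer depend on the input. *)
exists (fun c c' => [exists d : B, [exists b : B,
  [&& gb c == enum_rank b, gb c' == enum_rank (b ^ d) &
   [forall t, D (prod_code d (b ^ d) t c) (prod_code 1 (b ^ d) t c')]]]]) => [|u v].
  have prodP d b t m F : computable m F -> computable m (fun v => prod_code d b t (F v)).
    move=> FP; apply: computable_foldr catP _ => s.
    exact: computable_comp1 (glP _).1 FP.
  apply: computable_exists => d; apply: computable_exists => b.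
  apply: computable_and; last apply: computable_and.
  - by apply: computable_eqn (computable_const _ _); apply: computable_comp1 gbP (computable_nth _ _).
  - by apply: computable_eqn (computable_const _ _); apply: computable_comp1 gbP (computable_nth _ _).
  - by apply: computable_forall => t; apply: (computable_comp2 DP); apply: prodP; apply: computable_nth.
have prodE d b t w : exists2 W, prod_code d b t (word_code w) = word_code W &
    word_val xA W = \prod_(s <- fingraph.orbit (translate to val psi b) t)
      (word_val (wreath_gens to xA xB s0) w).2 (to (val s) d^-1).
  exists (flatten [seq lamp_word to xA xB s0 (to (val s) d^-1) w |
                   s <- fingraph.orbit (translate to val psi b) t]).
    rewrite /prod_code; elim: (fingraph.orbit _ _) => //= s r ->.
    by rewrite (glP _).2 catE.
  by rewrite word_val_flatten; apply: eq_bigr => s _; rewrite lamp_wordE.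
have DprodE d b t : D (prod_code d b t (word_code u)) (prod_code 1 b t (word_code v)) <->
    are_conjugate
      (\prod_(s <- fingraph.orbit (translate to val psi b) t)
        (word_val (wreath_gens to xA xB s0) u).2 (to (val s) d^-1))
      (\prod_(s <- fingraph.orbit (translate to val psi b) t)
        (word_val (wreath_gens to xA xB s0) v).2 (val s)).
  have [U -> <-] := prodE d b t u; have [V -> VE] := prodE 1 b t v.
  rewrite -DE VE; set P := \prod_(s <- _) _; set Q := \prod_(s <- _) _.
  (* The second product is [prod_code] at 1, where the translation is trivial. *)
  have -> // : P = Q.
  by apply: eq_bigr => s _; rewrite invg1 total_act1.
rewrite (wreath_conjugateP phiK psiK); split=> [[d [uv conj_uv]]|].
  apply/existsP; exists d; apply/existsP; exists (word_val (wreath_gens to xA xB s0) u).1.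
  rewrite !gbE uv !eqxx /=; apply/forallP => t; exact/DprodE.
case/existsP=> d /existsP[b /and3P[]]; rewrite !gbE.
move=> /eqP/val_inj/enum_rank_inj ub /eqP/val_inj/enum_rank_inj vb /forallP Dt.
by exists d; rewrite ub vb; split=> // t; apply/DprodE.
Qed.
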